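(* Let $\gamma$ be a probability level and let $\alpha$ satisfy $\alpha<\gamma$ and $\alpha\ge\alpha^*$, where $\alpha^*$ is the output of the threshold algorithm (described in the context) on input $\gamma,\{p_i\}_{i=1}^n,b$. Let $(\mathrm R)$ be the first-level RLT relaxation (described in the context) of the bilinear problem computing $\min_{(x,T(x))\in\mathcal X_T}\mathbb E_{\alpha-\gamma}[\mathbb T(x)]$, and let $\nu_V^*=\min_{(x,T(x))\in\mathcal X_T}\mathrm{VaR}_\gamma\mathbb T(x)$. Then the underestimate for $\nu^*_V$ obtained from $(\mathrm R)$ can be improved by: (a) replacing $\theta_i\ge\theta^w_{ii}$ in $(\mathrm R)$ with $\theta_i=\theta^w_{ii}$ for all $i\in[n]$; (b) replacing $\theta_i+sp_i-T_i(x)p_i\ge0$ in $(\mathrm R)$ with $\theta_i+s^w_ip_i-T^w_{ii}(x)p_i=0$ and $s-s^w_i-T_i(x)+T^w_{ii}(x)\ge0$ for all $i\in[n]$. That is, if $(\mathrm R_I)$ denotes the problem obtained from $(\mathrm R)$ by making both replacements, and $\mathrm R^*$, $\mathrm R_I^*$ are the optimal values of $(\mathrm R)$ and $(\mathrm R_I)$, then $\mathrm R^*\le\mathrm R_I^*\le\nu_V^*$.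
   Context: $[n]=\{1,\dots,n\}$. Let $\mathcal X\subseteq\mathbb R^k$ be nonempty and let $Y$ be a discrete random vector in $\mathbb R^m$ having $n$ distinct realizations (atoms) $y_1,\dots,y_n$ with probabilities $p_1,\dots,p_n$ ($p_i>0$, $\sum_ip_i=1$). Let $f:\mathcal X\times\mathbb R^m\to\mathbb R$ be such that for each fixed realization $y$ of $Y$, $f(x,y)$ is linear in $x$. For $x\in\mathcal X$ put $\mathbb T(x)=f(x,Y)$, $T_i(x)=f(x,y_i)$, $T(x)=(T_1(x),\dots,T_n(x))$; $\mathbb T(x)$ takes the values $T_i(x)$ with associated probabilities $p_i$, and $F$ is its cdf. Probability levels are numbers in $[0,1]$. The constraints $x\in\mathcal X$ and $T_i(x)=f(x,y_i)$, $i\in[n]$, are represented as $Ax+BT(x)\le c$ with $A\in\mathbb R^{l\times k}$, $B\in\mathbb R^{l\times n}$, $c\in\mathbb R^l$, and $\mathcal X_T=\{(x,T(x)):Ax+BT(x)\le c\}$ is assumed nonempty, closed and convex. Here $\min$ of an optimization problem denotes its optimal value. $\mathrm{VaR}_p\mathbb T(x)=\inf\{\eta:\mathbb P(\mathbb T(x)\le\eta)\ge p\}=F^{-1}(p)$. For $0\le\alpha<1$, $\mathbb E_{\alpha-1}[\mathbb T(x)]=\frac1{1-\alpha}\max\{\sum_iT_i(x)w_ip_i:w\in[0,1]^n,\sum_iw_ip_i=1-\alpha\}$, and for $0\le\alpha<\gamma\le1$, $\mathbb E_{\alpha-\gamma}[\mathbb T(x)]=\frac1{\gamma-\alpha}\big((1-\alpha)\mathbb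 E_{\alpha-1}[\mathbb T(x)]-(1-\gamma)\mathbb E_{\gamma-1}[\mathbb T(x)]\big)$ (last term $0$ if $\gamma=1$), equivalently $\frac1{\gamma-\alpha}\int_\alpha^\gamma F^{-1}(p)dp$. Threshold algorithm. Input: $\gamma$, $\{p_i\}$, a positive integer $b$. For real $a$ let $O(a)=\min\{O:O\ge\sum_i\eta_ip_i\ge a,\ \eta\in\{0,1\}^n\}$. Start with $\alpha_0=0$, $O^*=O(\alpha_0)$, $k=1$. While $O^*<\gamma$: set $\alpha_k=\alpha_{k-1}+\frac{\gamma-\alpha_{k-1}}b$, set $O^*=O(\alpha_k)$, increase $k$ by one. When the loop stops, return as $\alpha^*$ the last computed value of $\alpha_k$. Bilinear problem: $\min_{x,T(x),s,\theta,w'}\frac1{\gamma-\alpha}\big((1-\alpha)s+\sum_i\theta_i-\sum_iT_i(x)p_iw'_i\big)$ subject to (i) $\theta_i+sp_i-T_i(x)p_i\ge0$ and $\theta_i\ge0$ for $i\in[n]$; (ii) $w'\in[0,1]^n$, $\sum_iw'_ip_i=1-\gamma$; (iii) $(x,T(x))\in\mathcal X_T$. Relaxation $(\mathrm R)$. Introduce additional real variables, linearizing the indicated products: $T^w_{ij}(x)$ for $T_i(x)w'_j$, $\theta^w_{ij}$ for $\theta_iw'_j$ ($i,j\in[n]$), $x^w_{qj}$ for $x_qw'_j$ ($q\in[k],j\in[n]$), and $s^w_j$ for $sw'_j$ ($j\in[n]$). $(\mathrm R)$ minimizes $\frac1{\gamma-\alpha}\big((1-\alpha)s+\sum_i(\theta_i-T^w_{ii}(x)p_i)\big)$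 over all variables $x,T(x),s,\theta,w'$ and linearizing variables, subject to (i), (ii), (iii) and, for all $i,j\in[n]$ and $r\in[l]$: - $\theta^w_{ij}+p_is^w_j-p_iT^w_{ij}(x)\ge0$; - $\theta_i+sp_i-T_i(x)p_i-(\theta^w_{ij}+p_is^w_j-p_iT^w_{ij}(x))\ge0$; - $\sum_{j}p_j(\theta^w_{ij}+p_is^w_j-p_iT^w_{ij}(x))-(1-\gamma)(\theta_i+sp_i-T_i(x)p_i)=0$; - $\theta^w_{ij}\ge0$, $\ \theta_i-\theta^w_{ij}\ge0$, $\ \sum_jp_j\theta^w_{ij}-(1-\gamma)\theta_i=0$; - $\sum_{q\in[k]}A_{rq}x^w_{qj}+\sum_{h\in[n]}B_{rh}T^w_{hj}(x)-c_rw'_j\le0$; - $\sum_qA_{rq}x_q+\sum_hB_{rh}T_h(x)-c_r-\big(\sum_qA_{rq}x^w_{qj}+\sum_hB_{rh}T^w_{hj}(x)-c_rw'_j\big)\le0$; - $\sum_{j}p_j\big(\sum_qA_{rq}x^w_{qj}+\sum_hB_{rh}T^w_{hj}(x)-c_rw'_j\big)-(1-\gamma)\big(\sum_qA_{rq}x_q+\sum_hB_{rh}T_h(x)-c_r\big)=0$. *)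

(* Defs.v *)
From HB Require Import structures.
From mathcomp Require Export all_boot all_order all_algebra.
From mathcomp Require Export all_classical all_reals all_analysis.
Export Order.TTheory GRing.Theory Num.Theory.
Export numFieldNormedType.Exports.

Set Implicit Arguments.
Unset Strict Implicit.
Unset Printing Implicit Defensive.

Local Open Scope classical_set_scope.
Local Open Scope ring_scope.

(* Extended-real valued, so that VaR_0 = -oo is covered by the same formula. *)
Definition VaR d (Omega : measurableType d) (R : realType)
    (P : probability Omega R) (Z : Omega -> R) (q : R) : \bar R :=
  ereal_inf [set eta%:E | eta in
    [set eta : R | (q%:E <= P [set w | (Z w <= eta)%R])%E]].

(* A real infimum: for a <= \sum_i p i the set is nonempty and, the subset sums
   being finitely many, its infimum is a minimum. *)
Definition subset_sum_above (R : realType) (n : nat) (p : 'I_n -> R) (a : R) : R :=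
  inf [set O : R | exists eta : 'I_n -> bool,
         a <= \sum_(i < n) (eta i)%:R * p i <= O].

(* [threshold_loop gamma p b a r]: the while loop, entered with current value
   [a] of alpha_k, terminates and leaves alpha_k with the value [r]. *)
Inductive threshold_loop (R : realType) (n : nat) (gamma : R) (p : 'I_n -> R)
    (b : nat) : R -> R -> Prop :=
| threshold_exit a :
    gamma <= subset_sum_above p a -> threshold_loop gamma p b a a
| threshold_iter a r :
    subset_sum_above p a < gamma ->
    threshold_loop gamma p b (a + (gamma - a) / b%:R) r ->
    threshold_loop gamma p b a r.

Definition threshold_output (R : realType) (n : nat) (gamma : R) (p : 'I_n -> R)
    (b : nat) (alpha_star : R) : Prop :=
  threshold_loop gamma p b 0 alpha_star.

Definition XT (R : realType) (k n l : nat) (A : 'M[R]_(l, k)) (B : 'M[R]_(l, n))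
    (c : 'cV[R]_l) : set ('cV[R]_k * 'cV[R]_n) :=
  [set z | forall r : 'I_l, (A *m z.1 + B *m z.2) r 0 <= c r 0].

(* [Tw i j], [thetaw i j], [xw q j], [sw j] linearize the products
   T_i w'_j, theta_i w'_j, x_q w'_j, s w'_j; [w] is w'. *)
Record rlt_point (R : realType) (k n : nat) := RltPoint {
  rx : 'cV[R]_k;
  rT : 'cV[R]_n;
  rs : R;
  rtheta : 'I_n -> R;
  rw : 'I_n -> R;
  rTw : 'I_n -> 'I_n -> R;
  rthetaw : 'I_n -> 'I_n -> R;
  rxw : 'I_k -> 'I_n -> R;
  rsw : 'I_n -> R
}.

Definition rlt_objective (R : realType) (k n : nat) (p : 'I_n -> R)
    (alpha gamma : R) (v : rlt_point R k n) : R :=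
  (gamma - alpha)^-1 *
    ((1 - alpha) * rs v + \sum_(i < n) (rtheta v i - rTw v i i * p i)).

(* theta_i + s p_i - T_i p_i *)
Definition slack (R : realType) (k n : nat) (p : 'I_n -> R)
    (v : rlt_point R k n) (i : 'I_n) : R :=
  rtheta v i + rs v * p i - rT v i 0 * p i.

(* theta^w_ij + p_i s^w_j - p_i T^w_ij, the linearization of slack_i * w'_j *)
Definition slackw (R : realType) (k n : nat) (p : 'I_n -> R)
    (v : rlt_point R k n) (i j : 'I_n) : R :=
  rthetaw v i j + p i * rsw v j - p i * rTw v i j.

(* row r of A x + B T - c *)
Definition resid (R : realType) (k n l : nat) (A : 'M[R]_(l, k))
    (B : 'M[R]_(l, n)) (c : 'cV[R]_l) (v : rlt_point R k n) (r : 'I_l) : R :=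
  \sum_(q < k) A r q * rx v q 0 + \sum_(h < n) B r h * rT v h 0 - c r 0.

(* the linearization of resid_r * w'_j *)
Definition residw (R : realType) (k n l : nat) (A : 'M[R]_(l, k))
    (B : 'M[R]_(l, n)) (c : 'cV[R]_l) (v : rlt_point R k n)
    (r : 'I_l) (j : 'I_n) : R :=
  \sum_(q < k) A r q * rxw v q j + \sum_(h < n) B r h * rTw v h j
    - c r 0 * rw v j.

(* The constraints common to (R) and (R_I), i.e. all those of (R) except
   theta_i + s p_i - T_i p_i >= 0 and the diagonal cases theta_i >= theta^w_ii. *)
Record rlt_common (R : realType) (k n l : nat) (A : 'M[R]_(l, k))
    (B : 'M[R]_(l, n)) (c : 'cV[R]_l) (p : 'I_n -> R) (gamma : R)
    (v : rlt_point R k n) : Prop := RltCommon {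
  rlt_theta_ge0 : forall i, 0 <= rtheta v i;
  rlt_w01 : forall i, 0 <= rw v i <= 1;
  rlt_w_sum : \sum_(i < n) rw v i * p i = 1 - gamma;
  rlt_XT : XT A B c (rx v, rT v);
  rlt_slackw_ge0 : forall i j, 0 <= slackw p v i j;
  rlt_slack_compl : forall i j, 0 <= slack p v i - slackw p v i j;
  rlt_slack_sum : forall i,
    \sum_(j < n) p j * slackw p v i j - (1 - gamma) * slack p v i = 0;
  rlt_thetaw_ge0 : forall i j, 0 <= rthetaw v i j;
  rlt_theta_compl : forall i j, i != j -> 0 <= rtheta v i - rthetaw v i j;
  rlt_theta_sum : forall i,
    \sum_(j < n) p j * rthetaw v i j - (1 - gamma) * rtheta v i = 0;
  rlt_residw_le0 : forall r j, residw A B c v r j <= 0;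
  rlt_resid_compl : forall r j, resid A B c v r - residw A B c v r j <= 0;
  rlt_resid_sum : forall r,
    \sum_(j < n) p j * residw A B c v r j - (1 - gamma) * resid A B c v r = 0
}.

Definition rlt_feasible (R : realType) (k n l : nat) (A : 'M[R]_(l, k))
    (B : 'M[R]_(l, n)) (c : 'cV[R]_l) (p : 'I_n -> R) (gamma : R) :
    set (rlt_point R k n) :=
  [set v | [/\ rlt_common A B c p gamma v,
               forall i, 0 <= slack p v i
             & forall i, rthetaw v i i <= rtheta v i]].

Definition rltI_feasible (R : realType) (k n l : nat) (A : 'M[R]_(l, k))
    (B : 'M[R]_(l, n)) (c : 'cV[R]_l) (p : 'I_n -> R) (gamma : R) :
    set (rlt_point R k n) :=
  [set v | [/\ rlt_common A B c p gamma v,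
               forall i, rtheta v i = rthetaw v i i,
               forall i, rtheta v i + rsw v i * p i - rTw v i i * p i = 0
             & forall i, 0 <= rs v - rsw v i - rT v i 0 + rTw v i i]].

Definition R_opt (R : realType) (k n l : nat) (A : 'M[R]_(l, k))
    (B : 'M[R]_(l, n)) (c : 'cV[R]_l) (p : 'I_n -> R) (alpha gamma : R) : \bar R :=
  ereal_inf [set (rlt_objective p alpha gamma v)%:E
            | v in rlt_feasible A B c p gamma].

Definition RI_opt (R : realType) (k n l : nat) (A : 'M[R]_(l, k))
    (B : 'M[R]_(l, n)) (c : 'cV[R]_l) (p : 'I_n -> R) (alpha gamma : R) : \bar R :=
  ereal_inf [set (rlt_objective p alpha gamma v)%:E
            | v in rltI_feasible A B c p gamma].

Definition VaR_opt d (Omega : measurableType d) (R : realType)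
    (P : probability Omega R) (k m n l : nat) (f : 'cV[R]_k -> 'cV[R]_m -> R)
    (Y : Omega -> 'cV[R]_m) (A : 'M[R]_(l, k)) (B : 'M[R]_(l, n))
    (c : 'cV[R]_l) (gamma : R) : \bar R :=
  ereal_inf [set VaR P (fun w => f z.1 (Y w)) gamma | z in XT A B c].

(* Main.v *)
Require Import Defs.
From mathcomp Require Import ring lra.

(** Restricting to (R_I) cannot lower the optimal value, because every point
    feasible for (R_I) is feasible for (R): [slack i] is the sum of the two
    nonnegative quantities [slackw i j] and [slack i - slackw i j].

    For the upper bound, fix [(x, T)] in X_T. Since [gamma > 0], the quantile
    VaR_gamma is attained at a realization [V = T_j], with
    P(T < V) < gamma <= P(T <= V). Consequently the mass [1 - gamma] can be
    placed on the upper tail: there are weights [w] in [[0, 1]], equal to [1]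
    above [V] and to [0] below [V], with [\sum_i w_i p_i = 1 - gamma]. Take
    [s = V], [theta_i = p_i max(T_i - V, 0)], and let every linearizing variable
    be the product that it stands for. All the constraints of (R) that involve
    products then hold, being products of valid inequalities, and those added in
    (R_I) are the complementarity relations
      [theta_i (1 - w_i) = 0],
      [theta_i + p_i w_i (V - T_i) = 0],
      [(1 - w_i) (V - T_i) >= 0],
    each of which is read off from the sign of [T_i - V]. Summing the middle
    relation over [i] shows that the objective at this point is exactly
      [((1 - alpha) V - (1 - gamma) V) / (gamma - alpha) = V].

    Positivity of [gamma], without which VaR_gamma is [-oo], comes from the
    threshold algorithm: its iterates increase from [0], whence
    [0 <= alpha_star <= alpha < gamma]. *)

Set Implicit Arguments.
Unset Strict Implicit.
Unset Printing Implicit Defensive.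

Local Open Scope classical_set_scope.
Local Open Scope ring_scope.

(** The step [(gamma - a) / b] never overshoots [gamma], as [b >= 1]; so [a]
    stays below [gamma] and each iteration can only increase it. *)
Lemma threshold_loop_ge (R : realType) (n : nat) (gamma : R) (p : 'I_n -> R)
    (b : nat) (a r : R) :
  (0 < b)%N -> threshold_loop gamma p b a r -> a <= gamma -> a <= r.
Proof.
move=> b_gt0; elim=> [//|{}a {}r _ _ IH a_le].
have step_ge0 : 0 <= (gamma - a) / b%:R by rewrite divr_ge0 ?subr_ge0.
have step_le : (gamma - a) / b%:R <= gamma - a.
  by rewrite ler_pdivrMr ?ltr0n// ler_peMr ?subr_ge0// ler1n.
by apply: le_trans (IH _); lra.
Qed.

(** * Quantiles of a finite weighted family *)

Lemma downset_max (R : realFieldType) (n : nat) (p t : 'I_n -> R)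
    (Q : pred 'I_n) :
  (forall i i', t i' <= t i -> Q i -> Q i') -> 0 < \sum_(i | Q i) p i ->
  exists2 j, Q j & Q =1 (fun i => t i <= t j).
Proof.
move=> Qdown Q_gt0.
have [i0 Qi0|Q0] := pickP Q; last by rewrite big_pred0 ?ltxx in Q_gt0.
case: (arg_maxP t Qi0) => j Qj jmax; exists j => // i.
by apply/idP/idP => [/jmax//|le_ij]; exact: Qdown Qj.
Qed.

(** The generalized inverse of a discrete cdf is attained at an atom. Take the
    atom [t j] minimal with cumulative mass at least [gamma]: were the mass
    strictly below [t j] already [gamma], the largest atom below [t j] would
    contradict minimality. *)
Lemma quantile_atom (R : realFieldType) (n : nat) (p t : 'I_n -> R)
    (gamma eta : R) :
  0 < gamma -> gamma <= \sum_(i | t i <= eta) p i ->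
  exists j, [/\ t j <= eta, \sum_(i | t i < t j) p i < gamma
              & gamma <= \sum_(i | t i <= t j) p i].
Proof.
move=> gamma_gt0 eta_ge.
have [|j0 j0_le j0E] := @downset_max R n p t (fun i => t i <= eta) _
    (lt_le_trans gamma_gt0 eta_ge).
  by move=> i i'; exact: le_trans.
have j0_ge : gamma <= \sum_(i | t i <= t j0) p i.
  by rewrite -(eq_bigl _ _ j0E).
case: (@arg_minP _ _ _ j0 (fun j => gamma <= \sum_(i | t i <= t j) p i) t
         j0_ge) => j j_ge jmin.
exists j; split=> //; first exact: le_trans (jmin _ j0_ge) j0_le.
rewrite ltNge; apply/negP => below_ge.
have [|j1 j1_lt j1E] := @downset_max R n p t (fun i => t i < t j) _
    (lt_le_trans gamma_gt0 below_ge).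
  by move=> i i'; exact: le_lt_trans.
by move: j1_lt; rewrite ltNge jmin// -(eq_bigl _ _ j1E).
Qed.

(** When [v] is a [gamma]-quantile, mass [1 - gamma] can be selected by taking
    everything above [v] and splitting the mass sitting at [v] evenly. *)
Lemma upper_tail_weights (R : realFieldType) (n : nat) (p t : 'I_n -> R)
    (gamma v : R) :
  \sum_(i < n) p i = 1 -> \sum_(i | t i < v) p i < gamma ->
  gamma <= \sum_(i | t i <= v) p i ->
  exists w : 'I_n -> R,
    [/\ forall i, 0 <= w i <= 1, \sum_(i < n) w i * p i = 1 - gamma,
        forall i, t i < v -> w i = 0 & forall i, v < t i -> w i = 1].
Proof.
move=> p_sum lo hi.
set a := \sum_(i | t i < v) p i in lo; set ae := \sum_(i | _) p i in hi.
(* the fraction of the mass [ae - a] at [v] that reaches beyond [gamma] *)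
pose lam := (ae - gamma) / (ae - a).
have den_gt0 : 0 < ae - a by lra.
have lam01 : 0 <= lam <= 1.
  by rewrite /lam divr_ge0 ?ler_pdivrMr//; lra.
pose w i := if t i < v then 0 else if t i <= v then lam else 1.
exists w; split => [i||i iv|i iv].
- rewrite /w; case: ifP => _; first by rewrite lexx ler01.
  by case: ifP; rewrite // ler01 lexx.
- have -> : \sum_(i < n) w i * p i
      = \sum_(i < n) p i - ae + lam * (ae - a).
    rewrite /ae /a [\sum_(i | t i <= v) _]big_mkcond.
    rewrite [\sum_(i | t i < v) _]big_mkcond -!sumrB mulr_sumr.
    rewrite -big_split; apply: eq_bigr => i _ /=.
    by rewrite /w; case: ltgtP => _; ring.
  by rewrite p_sum /lam divfK ?gt_eqF//; ring.
- by rewrite /w iv.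
- by rewrite /w ltNge (ltW iv) leNgt iv.
Qed.

(** * The law of a function of a discrete random vector *)

Lemma measurable_atom d (Omega : measurableType d) (R : realType) (m : nat)
    (Y : Omega -> 'cV[R]_m) (a : 'cV[R]_m) :
  (forall j, measurable_fun [set: Omega] (fun w => Y w j 0)) ->
  measurable [set w | Y w = a].
Proof.
move=> Y_meas.
have -> : [set w | Y w = a]
    = \bigcap_(j in [set: 'I_m]) ((fun w => Y w j 0) @^-1` [set a j 0]).
  apply/seteqP; split => w /= => [Yw j _|Yw]; first by rewrite /= Yw.
  by apply/matrixP => i j; rewrite ord1; exact: (Yw i I).
apply: fin_bigcap_measurable => [|j _]; first exact: finite_finset.
rewrite -[X in measurable X]setTI; exact: Y_meas.
Qed.

Lemma discrete_prob d (Omega : measurableType d) (R : realType)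
    (P : probability Omega R) (m n : nat) (Y : Omega -> 'cV[R]_m)
    (y : 'I_n -> 'cV[R]_m) (p : 'I_n -> R) (Q : pred 'cV[R]_m) :
  (forall j, measurable_fun [set: Omega] (fun w => Y w j 0)) ->
  injective y -> range Y = range y ->
  (forall i, P [set w | Y w = y i] = (p i)%:E) ->
  P [set w | Q (Y w)] = (\sum_(i | Q (y i)) p i)%:E.
Proof.
move=> Y_meas y_inj Y_range Y_law.
have -> : [set w | Q (Y w)]
    = \big[setU/set0]_(i < n | Q (y i)) [set w | Y w = y i].
  rewrite -bigcup_seq_cond; apply/seteqP.
  split=> [w Qw|w [i /= /andP[_ Qi] Yw]]; last first.
    by rewrite /= Yw.
  have [i _ yi] : range y (Y w) by rewrite -Y_range; exact: imageT.
  by exists i; rewrite /= ?mem_index_enum yi.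
rewrite measure_bigsetU_ord => [|i|]; last 2 first.
- exact: measurable_atom.
- apply/trivIsetP => i j _ _ /eqP ij; apply/seteqP.
  by split => w //= [] -> /y_inj.
by rewrite -sumEFin; apply: eq_bigr => i _; exact: Y_law.
Qed.

(** * Points of the relaxations given by genuine products *)

Definition product_point (R : realType) (k n : nat) (x : 'cV[R]_k)
    (T : 'cV[R]_n) (s : R) (theta w : 'I_n -> R) : rlt_point R k n :=
  RltPoint x T s theta w
    (fun i j => T i 0 * w j) (fun i j => theta i * w j)
    (fun q j => x q 0 * w j) (fun j => s * w j).

Lemma slackw_product (R : realType) (k n : nat) (p : 'I_n -> R) (x : 'cV[R]_k)
    (T : 'cV[R]_n) (s : R) (theta w : 'I_n -> R) (i j : 'I_n) :
  let v := product_point x T s theta w in slackw p v i j = slack p v i * w j.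
Proof. by rewrite /slackw /slack /=; ring. Qed.

Lemma residw_product (R : realType) (k n l : nat) (A : 'M[R]_(l, k))
    (B : 'M[R]_(l, n)) (c : 'cV[R]_l) (x : 'cV[R]_k) (T : 'cV[R]_n) (s : R)
    (theta w : 'I_n -> R) (r : 'I_l) (j : 'I_n) :
  let v := product_point x T s theta w in
  residw A B c v r j = resid A B c v r * w j.
Proof.
rewrite /residw /resid /= mulrBl mulrDl !mulr_suml.
by congr (_ + _ - _); apply: eq_bigr => h _; rewrite mulrA.
Qed.

Lemma sum_product_weight (R : comPzRingType) (n : nat) (p w : 'I_n -> R)
    (a M : R) :
  \sum_(j < n) w j * p j = M -> \sum_(j < n) p j * (a * w j) - M * a = 0.
Proof.
move=> <-; rewrite mulr_suml -sumrB big1// => j _; ring.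
Qed.

(** Each constraint of the relaxation is the product of a valid inequality with
    [w j >= 0], with [1 - w j >= 0], or with the equation
    [\sum_j p_j w_j = 1 - gamma]. *)
Lemma product_point_common (R : realType) (k n l : nat) (A : 'M[R]_(l, k))
    (B : 'M[R]_(l, n)) (c : 'cV[R]_l) (p : 'I_n -> R) (gamma : R)
    (x : 'cV[R]_k) (T : 'cV[R]_n) (s : R) (theta w : 'I_n -> R) :
  let v := product_point x T s theta w in
  XT A B c (x, T) -> (forall i, 0 <= theta i) -> (forall i, 0 <= slack p v i) ->
  (forall i, 0 <= w i <= 1) -> \sum_(i < n) w i * p i = 1 - gamma ->
  rlt_common A B c p gamma v.
Proof.
move=> v xT theta_ge0 slack_ge0 w01 w_sum.
have w_ge0 j : 0 <= w j by case/andP: (w01 j).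
have w_le1 j : 0 <= 1 - w j by rewrite subr_ge0; case/andP: (w01 j).
have resid_le0 r : resid A B c v r <= 0.
  by rewrite subr_le0; move: (xT r); rewrite !mxE.
split=> //= => [i j|i j|i|i j|i j _|i|r j|r j|r].
- by rewrite slackw_product mulr_ge0.
- by rewrite slackw_product -{1}[slack p v i]mulr1 -mulrBr mulr_ge0.
- under eq_bigr => j _ do rewrite slackw_product.
  exact: sum_product_weight.
- by rewrite mulr_ge0.
- by rewrite -{1}[theta i]mulr1 -mulrBr mulr_ge0.
- exact: sum_product_weight.
- by rewrite residw_product mulr_le0_ge0.
- by rewrite residw_product -{1}[resid _ _ _ _ _]mulr1 -mulrBr mulr_le0_ge0.
- under eq_bigr => j _ do rewrite residw_product.
  exact: sum_product_weight.
Qed.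

(** * Comparison of the optimal values *)

Lemma rltI_feasible_sub (R : realType) (k n l : nat) (A : 'M[R]_(l, k))
    (B : 'M[R]_(l, n)) (c : 'cV[R]_l) (p : 'I_n -> R) (gamma : R) :
  rltI_feasible A B c p gamma `<=` rlt_feasible A B c p gamma.
Proof.
move=> v [v_common thetaE _ _]; split=> // i; last by rewrite -thetaE.
rewrite -[slack p v i](subrK (slackw p v i i)) addr_ge0//.
- exact: (rlt_slack_compl v_common).
- exact: (rlt_slackw_ge0 v_common).
Qed.

(** The superquantile variables [s = v], [theta_i = p_i max(T_i - v, 0)] and the
    upper-tail weights agree on where the tail starts: [w_i = 1] wherever
    [theta_i > 0], and [w_i = 0] wherever [T_i < v]. Hence the equations added
    in (R_I) hold at their products, and the excesses over [v] cancel in the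
    objective. *)
Lemma quantile_point (R : realType) (k n l : nat) (A : 'M[R]_(l, k))
    (B : 'M[R]_(l, n)) (c : 'cV[R]_l) (p : 'I_n -> R) (alpha gamma v : R)
    (x : 'cV[R]_k) (T : 'cV[R]_n) :
  (forall i, 0 < p i) -> \sum_(i < n) p i = 1 -> alpha < gamma ->
  XT A B c (x, T) -> \sum_(i | T i 0 < v) p i < gamma ->
  gamma <= \sum_(i | T i 0 <= v) p i ->
  exists2 z, rltI_feasible A B c p gamma z & rlt_objective p alpha gamma z = v.
Proof.
move=> p_gt0 p_sum alpha_lt xT lo hi.
have [w [w01 w_sum w_lo w_hi]] := upper_tail_weights p_sum lo hi.
pose theta i := p i * Num.max (T i 0 - v) 0.
have theta_ge0 i : 0 <= theta i.
  by apply: mulr_ge0; [exact: ltW|rewrite le_max lexx orbT].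
pose z := product_point x T v theta w.
have excess_eq i : theta i + v * w i * p i - T i 0 * w i * p i = 0.
  rewrite /theta; case: (ltgtP (T i 0) v) => Tv.
  - by rewrite w_lo// max_r ?subr_le0 ?ltW//; ring.
  - by rewrite w_hi// max_l ?subr_ge0 ?ltW//; ring.
  - by rewrite Tv subrr maxxx; ring.
exists z.
- split => [|i|//|i].
  + apply: product_point_common => // i; rewrite /slack /=.
    have : p i * (T i 0 - v) <= theta i.
      by apply: ler_wpM2l; [exact: ltW|rewrite le_max lexx].
    by lra.
  + rewrite /= /theta; case: (leP (T i 0) v) => Tv; last by rewrite w_hi ?mulr1.
    by rewrite max_r ?subr_le0// !(mulr0, mul0r).
  + rewrite /=; have -> : v - v * w i - T i 0 + T i 0 * w i
      = (1 - w i) * (v - T i 0) by ring.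
    case: (leP (T i 0) v) => Tv; last by rewrite w_hi// subrr mul0r.
    by rewrite mulr_ge0// subr_ge0//; case/andP: (w01 i).
- have objE i : theta i - T i 0 * w i * p i = - v * (w i * p i).
    by have := excess_eq i; lra.
  rewrite /rlt_objective /=; under eq_bigr => i _ do rewrite objE.
  rewrite -mulr_sumr w_sum.
  have -> : (1 - alpha) * v + - v * (1 - gamma) = (gamma - alpha) * v by ring.
  by rewrite mulKf// subr_eq0 gt_eqF.
Qed.

Theorem proposition5 (R : realType) (d : measure_display)
    (Omega : measurableType d) (P : probability Omega R)
    (k m n l : nat)
    (X : set 'cV[R]_k) (X_neq0 : X !=set0)
    (Y : Omega -> 'cV[R]_m)
    (Y_meas : forall j : 'I_m, measurable_fun [set: Omega] (fun w => Y w j 0))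
    (y : 'I_n -> 'cV[R]_m) (y_inj : injective y)
    (Y_range : range Y = range y)
    (p : 'I_n -> R) (p_gt0 : forall i, 0 < p i) (p_sum : \sum_(i < n) p i = 1)
    (Y_law : forall i, P [set w | Y w = y i] = (p i)%:E)
    (f : 'cV[R]_k -> 'cV[R]_m -> R)
    (f_lin : forall i : 'I_n, exists g : {scalar 'cV[R]_k},
        forall x, X x -> f x (y i) = g x)
    (A : 'M[R]_(l, k)) (B : 'M[R]_(l, n)) (c : 'cV[R]_l)
    (repr : forall (x : 'cV[R]_k) (t : 'cV[R]_n),
        XT A B c (x, t) <-> (X x /\ forall i : 'I_n, t i 0 = f x (y i)))
    (XT_neq0 : XT A B c !=set0)
    (XT_closed : closed (XT A B c))
    (XT_convex : convex_set (XT A B c))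
    (gamma : R) (gamma01 : 0 <= gamma <= 1)
    (b : nat) (b_gt0 : (0 < b)%N)
    (alpha_star : R) (alpha_starE : threshold_output gamma p b alpha_star)
    (alpha : R) (alpha_ge : alpha_star <= alpha) (alpha_lt : alpha < gamma) :
  (R_opt A B c p alpha gamma <= RI_opt A B c p alpha gamma)%E /\
  (RI_opt A B c p alpha gamma <= VaR_opt P f Y A B c gamma)%E.
Proof.
split.
  by apply: ereal_inf_le_tmp; apply: image_subset; exact: rltI_feasible_sub.
have gamma_gt0 : 0 < gamma.
  have [gamma_ge0 _] := andP gamma01.
  by have := threshold_loop_ge b_gt0 alpha_starE gamma_ge0; lra.
apply: le_ereal_inf_tmp => _ [[x T] xT <-].
have [_ TE] := (repr x T).1 xT.
apply: le_ereal_inf_tmp => _ [eta /= eta_ge <-].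
have {}eta_ge : gamma <= \sum_(i | T i 0 <= eta) p i.
  rewrite -lee_fin (le_trans eta_ge)//.
  rewrite (discrete_prob (fun u => f x u <= eta) Y_meas y_inj Y_range Y_law).
  by under [in leRHS]eq_bigl => i do rewrite TE.
have [j [j_le lo hi]] := quantile_atom (t := fun i => T i 0) gamma_gt0 eta_ge.
have [z z_feas zE] := quantile_point p_gt0 p_sum alpha_lt xT lo hi.
apply: ge_ereal_inf; exists (rlt_objective p alpha gamma z)%:E.
  by exists z.
by rewrite zE lee_fin.
Qed.
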